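(* Let $K$ and $L$ be Lie groups with Lie algebras $\mathfrak{k}$ and $\mathfrak{l}$, let $H=U(\mathfrak{k})\,\triangleright\!\!\!\blacktriangleleft F(L)$ be a bicrossproduct Hopf algebra, and $H^*=F(K)\blacktriangleright\!\!\!\triangleleft\,U(\mathfrak{l})$ its dual. For $k,k'\in K$, $\lambda,\lambda'\in F(L)$, $\kappa\in F(K)$ and $l\in L$, the action on each of the four regular $H$-modules is: $$\begin{array}{lll} (H,\prec,H): & (k\lambda)\prec k'=kk'(\lambda\triangleleft k'), & (k\lambda)\prec\lambda'=k\lambda\lambda';\\ (H^*,\succ,H): & k'\succ(\kappa l)=(k'\succ\kappa)(k'\triangleright l), & \lambda'\succ(\kappa l)=\lambda'(l)\,\kappa l;\\ (H,\succ,H): & k'\succ(k\lambda)=k'k\lambda, & \lambda'\succ(k\lambda)=k(\lambda'\triangleleft k)\lambda;\\ (H^*,\prec,H): & (\kappa l)\prec k'=(\kappa\prec k')l, & (\kappa l)\prec\lambda'=\kappa(\lambda'\circ\hat l)\,l; \end{array}$$ where $\hat l:K\to L$ is the map $\hat l(k)=k\triangleright l$.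
   Context: $F(K)$, $F(L)$ denote the algebras of $\mathbb{C}$-valued smooth functions on $K$, $L$. In the bicrossproduct $H=U(\mathfrak{k})\triangleright\!\!\!\blacktriangleleft F(L)$, $F(L)$ is a right $U(\mathfrak{k})$-module algebra (action $\triangleleft$), $U(\mathfrak{k})$ is a left $F(L)$-comodule coalgebra, and these satisfy the usual compatibility conditions; the product on $U(\mathfrak{k})\otimes F(L)$ (write $k\lambda=k\otimes\lambda$) is $(k\otimes\lambda)(k'\otimes\lambda')=kk'_{(1)}\otimes(\lambda\triangleleft k'_{(2)})\lambda'$ with $\Delta(k)=k_{(1)}\otimes k_{(2)}$. $H^*=F(K)\blacktriangleright\!\!\!\triangleleft U(\mathfrak{l})$ is the dual bicrossproduct, with underlying space $F(K)\otimes U(\mathfrak{l})$ (write $\kappa l=\kappa\otimes l$). Elements $k\in K$ (exponentials of elements of $\mathfrak{k}$) are regarded as group-like elements, $\Delta(k)=k\otimes k$, of (a completion of) $U(\mathfrak{k})$, and elements $l\in L$ as group-like elements of (a completion of) $U(\mathfrak{l})$; $H$ and $H^*$ are described by the elements $k\lambda$ and $\kappa l$. The pairings are $\langle k,\kappa\rangle=\kappa(k)$, $\langle\lambda,l\rangle=\lambda(l)$ and $\langle k\lambda,\kappa l\rangle=\kappa(k)\lambda(l)$; elements of $H^*$ are determined by their pairing with the elements $k\lambda$. The action of $U(\mathfrak{k})$ on $F(L)$ corresponds to a left action $(k,l)\mapsto k\triangleright l$ of $K$ on $L$: $(\lambda\triangleleft k)(l)=\lambda(k\triangleright l)$. This action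 is in general only local, in which case $\hat l$ is defined only near the identity of $K$ and $\kappa(\lambda'\circ\hat l)$ is understood in an enlargement of $F(K)$ such as a space of formal series. Regular modules: on $H$ the actions are multiplication, $h\prec h'=hh'$ and $h'\succ h=h'h$; on $H^*$ they are the dual actions $\langle h,h'\succ\eta\rangle=\langle hh',\eta\rangle$ and $\langle h,\eta\prec h'\rangle=\langle h'h,\eta\rangle$. On $F(K)$: $(k'\succ\kappa)(k)=\kappa(kk')$, $(\kappa\prec k')(k)=\kappa(k'k)$. *)

(* Defs.v *)
(* The base field is C = R[i] with R : realType, the real numbers.
   Function algebras F(G) are the predicate [smooth_fun] on raw functions
   G -> R[i] with their pointwise operations. *)
From HB Require Import structures.
From mathcomp Require Import all_boot all_order all_algebra.
From mathcomp Require Import all_classical all_reals all_analysis.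
From mathcomp Require Import complex.
Set Implicit Arguments.
Unset Strict Implicit.
Unset Printing Implicit Defensive.
Import Order.TTheory GRing.Theory Num.Theory.
Import numFieldNormedType.Exports.
Local Open Scope classical_set_scope.
Local Open Scope ring_scope.

(** * Smooth manifolds and Lie groups *)

(* f is of class C^m on the open set U of R^n, by iterated partial
   derivatives. *)
Fixpoint Ck (R : realType) (n : nat) (U : set 'rV[R]_n) (m : nat)
    (f : 'rV[R]_n -> R) : Prop :=
  (forall x, U x -> {for x, continuous f}) /\
  (if m is m'.+1 then
     forall i : 'I_n,
       (forall x, U x -> derivable f x (delta_mx 0 i)) /\
       Ck U m' (fun x => 'D_(delta_mx 0 i) f x)
   else True).

(* The values of ch_fwd outside ch_dom, and of ch_bwd outside
   ch_fwd @` ch_dom, are irrelevant. *)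
Record chart (R : realType) (T : topologicalType) (n : nat) := Chart {
  ch_dom : set T;
  ch_fwd : T -> 'rV[R]_n;
  ch_bwd : 'rV[R]_n -> T }.

Record chart_ok (R : realType) (T : topologicalType) (n : nat)
    (c : chart R T n) : Prop := ChartOk {
  ch_open : open (ch_dom c);
  ch_img_open : open (ch_fwd c @` ch_dom c);
  ch_fwdK : forall x, ch_dom c x -> ch_bwd c (ch_fwd c x) = x;
  ch_fwd_cont : forall x, ch_dom c x -> {for x, continuous (ch_fwd c)};
  ch_bwd_cont : forall v, (ch_fwd c @` ch_dom c) v ->
    {for v, continuous (ch_bwd c)} }.

Record charted (R : realType) := Charted {
  ct_sort :> topologicalType;
  ct_dim : nat;
  ct_atlas : set (chart R ct_sort ct_dim) }.

Definition charted_prod (R : realType) (M N : charted R) : charted R :=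
  @Charted R (M * N)%type (ct_dim M + ct_dim N)
    [set c | exists a b, [/\ ct_atlas a, ct_atlas b &
       c = Chart (ch_dom a `*` ch_dom b)
             (fun x => row_mx (ch_fwd a x.1) (ch_fwd b x.2))
             (fun v => (ch_bwd a (lsubmx v), ch_bwd b (rsubmx v)))]].

(* Smoothness of F on the open subset O of M. *)
Definition smooth_map (R : realType) (M N : charted R) (O : set M)
    (F : M -> N) : Prop :=
  (forall x, O x -> {for x, continuous F}) /\
  (forall c c', ct_atlas c -> ct_atlas c' -> forall i m,
    Ck (ch_fwd c @` (ch_dom c `&` O `&` F @^-1` ch_dom c')) m
       (fun v => ch_fwd c' (F (ch_bwd c v)) 0 i)).

Record is_manifold (R : realType) (M : charted R) : Prop := IsManifold {
  mf_hausdorff : hausdorff_space M;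
  mf_second_countable : @second_countable M;
  mf_chart : forall c, @ct_atlas R M c -> chart_ok c;
  mf_cover : forall x : M, exists2 c, ct_atlas c & ch_dom c x;
  mf_compat : @smooth_map R M M setT id }.

#[short(type="topGroupType")]
HB.structure Definition TopGroup := {T of Group T & Topological T}.

Record lieGroup (R : realType) := LieGroup {
  lg_sort :> topGroupType;
  lg_dim : nat;
  lg_atlas : set (chart R lg_sort lg_dim);
  lg_charted := @Charted R lg_sort lg_dim lg_atlas;
  lg_manifold : is_manifold lg_charted;
  lg_mul_smooth : @smooth_map R (charted_prod lg_charted lg_charted) lg_charted
    setT (fun x : lg_sort * lg_sort => (x.1 * x.2)%g);
  lg_inv_smooth : @smooth_map R lg_charted lg_charted
    setT (fun x : lg_sort => (x^-1)%g) }.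

Definition smoothR (R : realType) (G : lieGroup R) (f : G -> R) : Prop :=
  forall c, @lg_atlas R G c -> forall m,
    Ck (ch_fwd c @` ch_dom c) m (f \o ch_bwd c).

Definition smooth_fun (R : realType) (G : lieGroup R) (f : G -> R[i]) : Prop :=
  smoothR (fun x => complex.Re (f x)) /\ smoothR (fun x => complex.Im (f x)).

(** * The Lie algebra and its enveloping algebra *)

(* The Lie algebra consists of the left-invariant derivations of the algebra
   of real smooth functions.  Operators are raw functions, so they are
   compared on smooth functions only ([li_field_eq]). *)
Record li_field (R : realType) (G : lieGroup R) (X : (G -> R) -> G -> R)
    : Prop := LiField {
  lif_smooth : forall f, smoothR f -> smoothR (X f);
  lif_linear : forall a f g, smoothR f -> smoothR g -> forall x,
    X (fun y => a * f y + g y) x = a * X f x + X g x;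
  lif_leibniz : forall f g, smoothR f -> smoothR g -> forall x,
    X (fun y => f y * g y) x = X f x * g x + f x * X g x;
  lif_inv : forall f, smoothR f -> forall h x,
    X (fun y => f (h * y)%g) x = X f (h * x)%g }.

Definition li_field_eq (R : realType) (G : lieGroup R)
    (X Y : (G -> R) -> G -> R) : Prop :=
  forall f, smoothR f -> forall x, X f x = Y f x.

Definition li_comb (R : realType) (G : lieGroup R) (a : R)
    (X Y : (G -> R) -> G -> R) : (G -> R) -> G -> R :=
  fun f x => a * X f x + Y f x.

Definition li_bracket (R : realType) (G : lieGroup R)
    (X Y : (G -> R) -> G -> R) : (G -> R) -> G -> R :=
  fun f x => X (Y f) x - Y (X f) x.

Definition li_complex (R : realType) (G : lieGroup R)
    (X : (G -> R) -> G -> R) (f : G -> R[i]) : G -> R[i] :=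
  fun x => (X (fun y => complex.Re (f y)) x +i*
            X (fun y => complex.Im (f y)) x)%C.

Record lie_hom (R : realType) (G : lieGroup R) (A : algType R[i])
    (f : ((G -> R) -> G -> R) -> A) : Prop := LieHom {
  lh_eq : forall X Y, li_field X -> li_field Y -> li_field_eq X Y -> f X = f Y;
  lh_linear : forall a X Y, li_field X -> li_field Y ->
    f (li_comb a X Y) = a%:C%C *: f X + f Y;
  lh_bracket : forall X Y, li_field X -> li_field Y ->
    f (li_bracket X Y) = f X * f Y - f Y * f X }.

(* The complex enveloping algebra of the Lie algebra of G, by its universal
   property. *)
Definition is_enveloping (R : realType) (G : lieGroup R) (U : algType R[i])
    (iota : ((G -> R) -> G -> R) -> U) : Prop :=
  lie_hom iota /\
  forall (A : algType R[i]) (f : ((G -> R) -> G -> R) -> A), lie_hom f ->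
    exists F : {lrmorphism U -> A},
      (forall X, li_field X -> F (iota X) = f X) /\
      (forall F' : {lrmorphism U -> A},
         (forall X, li_field X -> F' (iota X) = f X) -> F' =1 F).

(** * Tensors and Hopf algebras *)

Definition bilin (C : fieldType) (V W Z : lmodType C) (B : V -> W -> Z) : Prop :=
  (forall a v v' w, B (a *: v + v') w = a *: B v w + B v' w) /\
  (forall a v w w', B v (a *: w + w') = a *: B v w + B v w').

Definition trilin (C : fieldType) (V W X Z : lmodType C) (B : V -> W -> X -> Z)
    : Prop :=
  [/\ forall a v v' w x, B (a *: v + v') w x = a *: B v w x + B v' w x,
      forall a v w w' x, B v (a *: w + w') x = a *: B v w x + B v w' x
    & forall a v w x x', B v w (a *: x + x') = a *: B v w x + B v w x'].

(* The list s represents the tensor \sum_(p <- s) p.1 \otimes p.2 ; two lists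
   represent the same tensor iff every bilinear map agrees on them. *)
Definition tens_eq (C : fieldType) (V W : lmodType C) (s t : seq (V * W)) : Prop :=
  forall (Z : lmodType C) (B : V -> W -> Z), bilin B ->
    \sum_(p <- s) B p.1 p.2 = \sum_(p <- t) B p.1 p.2.

(* In Sweedler notation, comul x lists the pairs (x_(1), x_(2)). *)
Record hopfAlg (C : fieldType) := HopfAlg {
  hopf_sort :> algType C;
  comul : hopf_sort -> seq (hopf_sort * hopf_sort);
  counit : {scalar hopf_sort};
  antipode : {linear hopf_sort -> hopf_sort};
  comul_linear : forall a x y, tens_eq (comul (a *: x + y))
    ([seq (a *: p.1, p.2) | p <- comul x] ++ comul y);
  comul1 : tens_eq (comul 1) [:: (1, 1)];
  comulM : forall x y, tens_eq (comul (x * y))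
    [seq (p.1 * q.1, p.2 * q.2) | p <- comul x, q <- comul y];
  comulA : forall x (Z : lmodType C) (T : hopf_sort -> hopf_sort -> hopf_sort -> Z),
    trilin T ->
    \sum_(p <- comul x) \sum_(q <- comul p.1) T q.1 q.2 p.2 =
    \sum_(p <- comul x) \sum_(q <- comul p.2) T p.1 q.1 q.2;
  counitl : forall x, \sum_(p <- comul x) counit p.1 *: p.2 = x;
  counitr : forall x, \sum_(p <- comul x) counit p.2 *: p.1 = x;
  counit1 : counit 1 = 1;
  counitM : forall x y, counit (x * y) = counit x * counit y;
  antipodel : forall x,
    \sum_(p <- comul x) antipode p.1 * p.2 = counit x *: 1;
  antipoder : forall x,
    \sum_(p <- comul x) p.1 * antipode p.2 = counit x *: 1 }.

Arguments counit {C h}.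
Arguments antipode {C h}.

(** * Completions of enveloping algebras *)

(* ue is U(g); ue_hat is a completion of it in which the elements of G are
   group-like, paired with F(G).  (Example: the distributions on G with
   finite support.)  The pairing accepts arbitrary functions, so that
   functions in an enlargement of F(G) can be evaluated at the elements of G;
   away from these it is constrained on smooth functions only. *)
Record envCompletion (R : realType) (G : lieGroup R) := EnvCompletion {
  ue : hopfAlg R[i];
  ue_in : ((G -> R) -> G -> R) -> ue;
  ue_env : is_enveloping ue_in;
  ue_prim : forall X, li_field X ->
    tens_eq (comul (ue_in X)) [:: (ue_in X, 1); (1, ue_in X)];
  ue_hat : hopfAlg R[i];
  ue_incl : {lrmorphism ue -> ue_hat};
  ue_incl_inj : injective ue_incl;
  ue_incl_comul : forall x, tens_eq (comul (ue_incl x))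
    [seq (ue_incl p.1, ue_incl p.2) | p <- comul x];
  ue_incl_counit : forall x, counit (ue_incl x) = counit x;
  glike : G -> ue_hat;
  glike1 : glike 1%g = 1;
  glikeM : forall g h, glike (g * h)%g = glike g * glike h;
  glike_comul : forall g, tens_eq (comul (glike g)) [:: (glike g, glike g)];
  glike_counit : forall g, counit (glike g) = 1;
  gpair : ue_hat -> (G -> R[i]) -> R[i];
  gpair_linl : forall a x y f, gpair (a *: x + y) f = a * gpair x f + gpair y f;
  gpair_linr : forall a x f f', smooth_fun f -> smooth_fun f' ->
    gpair x (fun g => a * f g + f' g) = a * gpair x f + gpair x f';
  gpair1r : forall x, gpair x (fun=> 1) = counit x;
  gpairMr : forall x f f', smooth_fun f -> smooth_fun f' ->
    gpair x (fun g => f g * f' g) =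
    \sum_(p <- comul x) gpair p.1 f * gpair p.2 f';
  gpairMl_smooth : forall y f, smooth_fun f ->
    smooth_fun (fun g => gpair y (fun h => f (g * h)%g));
  gpairMl : forall x y f, smooth_fun f ->
    gpair (x * y) f = gpair x (fun g => gpair y (fun h => f (g * h)%g));
  gpair_glike : forall g f, gpair (glike g) f = f g;
  gpair_lie : forall X f, li_field X -> smooth_fun f ->
    gpair (ue_incl (ue_in X)) f = li_complex X f 1%g }.

(** * Bicrossproducts *)

(* A local left action of K on L, defined on an open neighbourhood of
   {1} x L; it is global when la_dom is everything. *)
Record localAction (R : realType) (K L : lieGroup R) := LocalAction {
  la_dom : set (K * L);
  la_act : K -> L -> L;
  la_open : open la_dom;
  la_dom1 : forall l, la_dom (1%g, l);
  la_smooth : @smooth_map R (charted_prod (lg_charted K) (lg_charted L))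
    (lg_charted L) la_dom (fun x : K * L => la_act x.1 x.2);
  la_act1 : forall l, la_act 1%g l = l;
  la_actM : forall k k' l, la_dom (k', l) -> la_dom (k, la_act k' l) ->
    la_dom ((k * k')%g, l) -> la_act (k * k')%g l = la_act k (la_act k' l) }.

(* The data of a bicrossproduct Hopf algebra U(k) |><| F(L): F(L) is a right
   U(k)-module algebra via bd_act, the action being the one induced by the
   local action of K on L, and U(k) is a left F(L)-comodule coalgebra via
   bd_coact.  In Sweedler notation bd_coact x lists the pairs
   (x^(1), x^(2)) in F(L) x U(k); since F(L) (x) U(k) embeds into the maps
   L -> U(k), coactions are compared through [coact_at].  Similarly, the
   coproduct of F(L) takes its values in functions of two variables,
   a(l l'). *)
Definition coact_at (R : realType) (T : Type) (U : lmodType R[i])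
    (b : seq ((T -> R[i]) * U)) (l : T) : U :=
  \sum_(p <- b) p.1 l *: p.2.

Record bicrossData (R : realType) (K L : lieGroup R) (UK : envCompletion K)
    (a : localAction K L) := BicrossData {
  bd_act : (L -> R[i]) -> ue UK -> L -> R[i];
  bd_smooth : forall f x, smooth_fun f -> smooth_fun (bd_act f x);
  bd_linl : forall c f f' x l, smooth_fun f -> smooth_fun f' ->
    bd_act (fun m => c * f m + f' m) x l = c * bd_act f x l + bd_act f' x l;
  bd_linr : forall c f x y l, smooth_fun f ->
    bd_act f (c *: x + y) l = c * bd_act f x l + bd_act f y l;
  bd_act1 : forall f l, smooth_fun f -> bd_act f 1 l = f l;
  bd_actM : forall f x y l, smooth_fun f ->
    bd_act f (x * y) l = bd_act (bd_act f x) y l;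
  bd_alg1 : forall x l, bd_act (fun=> 1) x l = counit x;
  bd_algM : forall f f' x l, smooth_fun f -> smooth_fun f' ->
    bd_act (fun m => f m * f' m) x l =
    \sum_(p <- comul x) bd_act f p.1 l * bd_act f' p.2 l;
  bd_lie : forall f X l (kappa : K -> R[i]),
    smooth_fun f -> li_field X -> smooth_fun kappa ->
    (\forall k \near nbhs (1%g : K), kappa k = f (la_act a k l)) ->
    bd_act f (ue_in UK X) l = li_complex X kappa 1%g;
  bd_coact : ue UK -> seq ((L -> R[i]) * ue UK);
  bd_coact_smooth : forall x p, p \in bd_coact x -> smooth_fun p.1;
  bd_coact_lin : forall c x y l, coact_at (bd_coact (c *: x + y)) l =
    c *: coact_at (bd_coact x) l + coact_at (bd_coact y) l;
  bd_coact1 : forall x, coact_at (bd_coact x) 1%g = x;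
  bd_coactM : forall x l l', coact_at (bd_coact x) (l * l')%g =
    coact_at (bd_coact (coact_at (bd_coact x) l)) l';
  bd_coact_comul : forall x l, tens_eq (comul (coact_at (bd_coact x) l))
    [seq (coact_at (bd_coact p.1) l, coact_at (bd_coact p.2) l) | p <- comul x];
  bd_coact_counit : forall x l, counit (coact_at (bd_coact x) l) = counit x;
  (* epsilon(f <| x) = epsilon(f) epsilon(x) *)
  bd_compat_counit : forall f x, smooth_fun f ->
    bd_act f x 1%g = f 1%g * counit x;
  (* Delta(f <| x) =
       (f_(1) <| x_(1)) x_(2)^(1) (x) f_(2) <| x_(2)^(2) *)
  bd_compat_comul : forall f x l l', smooth_fun f ->
    bd_act f x (l * l')%g =
    \sum_(p <- comul x) \sum_(q <- bd_coact p.2)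
      bd_act (fun m => bd_act (fun n => f (m * n)%g) q.2 l') p.1 l * q.1 l;
  (* beta(1) = 1 (x) 1 *)
  bd_compat1 : forall l, coact_at (bd_coact 1) l = 1;
  (* beta(x y) = (x^(1) <| y_(1)) y_(2)^(1) (x) x^(2) y_(2)^(2) *)
  bd_compatM : forall x y l, coact_at (bd_coact (x * y)) l =
    \sum_(p <- comul y) \sum_(q <- bd_coact x)
      bd_act q.1 p.1 l *: (q.2 * coact_at (bd_coact p.2) l);
  (* x_(1)^(1) (f <| x_(2)) (x) x_(1)^(2) =
       (f <| x_(1)) x_(2)^(1) (x) x_(2)^(2) *)
  bd_compat_comm : forall f x l, smooth_fun f ->
    \sum_(p <- comul x) bd_act f p.2 l *: coact_at (bd_coact p.1) l =
    \sum_(p <- comul x) bd_act f p.1 l *: coact_at (bd_coact p.2) l }.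

(* The bicrossproduct extended to the completions.  When the action of K is
   only local, f <| k is not in F(L): it lives in an enlargement bc_fun of
   F(L), a right module algebra over the completion of U(k), in which F(L)
   maps equivariantly by bc_res, and whose elements pair with the completion
   of U(l).  When the action is global, f <| k is the element of F(L)
   given by l |-> f (k |> l) ([bc_act_global]).
   bc_alg is the tensor product of the completion of U(k) and of bc_fun
   (via bc_tens), with the bicrossproduct multiplication [bc_mul]; bc_pair is
   its pairing with (functions on K) (x) (completion of U(l)). *)
Record bicrossproduct (R : realType) (K L : lieGroup R) := Bicrossproduct {
  bc_K : envCompletion K;
  bc_L : envCompletion L;
  bc_loc : localAction K L;
  bc_data : bicrossData bc_K bc_loc;
  bc_fun : comAlgType R[i];
  bc_res : (L -> R[i]) -> bc_fun;
  bc_res_lin : forall c f f', smooth_fun f -> smooth_fun f' ->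
    bc_res (fun l => c * f l + f' l) = c *: bc_res f + bc_res f';
  bc_res1 : bc_res (fun=> 1) = 1;
  bc_resM : forall f f', smooth_fun f -> smooth_fun f' ->
    bc_res (fun l => f l * f' l) = bc_res f * bc_res f';
  bc_act : bc_fun -> ue_hat bc_K -> bc_fun;
  bc_act_bilin : bilin bc_act;
  bc_act1 : forall f, bc_act f 1 = f;
  bc_actM : forall f x y, bc_act f (x * y) = bc_act (bc_act f x) y;
  bc_act_alg1 : forall x, bc_act 1 x = counit x *: 1;
  bc_act_algM : forall f f' x, bc_act (f * f') x =
    \sum_(p <- comul x) bc_act f p.1 * bc_act f' p.2;
  bc_act_res : forall f x, smooth_fun f ->
    bc_act (bc_res f) (ue_incl bc_K x) = bc_res (bd_act bc_data f x);
  bc_act_global : (forall k l, la_dom bc_loc (k, l)) ->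
    forall f k, smooth_fun f ->
    bc_act (bc_res f) (glike bc_K k) = bc_res (fun l => f (la_act bc_loc k l));
  bc_fpair : bc_fun -> ue_hat bc_L -> R[i];
  bc_fpair_bilin : @bilin R[i] bc_fun (ue_hat bc_L) R[i]^o bc_fpair;
  bc_fpair1 : forall y, bc_fpair 1 y = counit y;
  bc_fpairM : forall f f' y, bc_fpair (f * f') y =
    \sum_(p <- comul y) bc_fpair f p.1 * bc_fpair f' p.2;
  bc_fpair_res : forall f y, smooth_fun f -> bc_fpair (bc_res f) y = gpair y f;
  (* (f <| k)(l) = f(k |> l) *)
  bc_fpair_act : forall f k l, smooth_fun f -> la_dom bc_loc (k, l) ->
    bc_fpair (bc_act (bc_res f) (glike bc_K k)) (glike bc_L l) =
    f (la_act bc_loc k l);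
  bc_alg : algType R[i];
  bc_tens : ue_hat bc_K -> bc_fun -> bc_alg;
  bc_tens_bilin : bilin bc_tens;
  bc_tens_univ : forall (Z : lmodType R[i]) (B : ue_hat bc_K -> bc_fun -> Z),
    bilin B -> exists F : {linear bc_alg -> Z},
      (forall x f, F (bc_tens x f) = B x f) /\
      (forall F' : {linear bc_alg -> Z},
         (forall x f, F' (bc_tens x f) = B x f) -> F' =1 F);
  bc_mul : forall x f y f', bc_tens x f * bc_tens y f' =
    \sum_(p <- comul y) bc_tens (x * p.1) (bc_act f p.2 * f');
  bc_pair : bc_alg -> (K -> R[i]) -> ue_hat bc_L -> R[i];
  bc_pair_lin : forall c h h' kappa y,
    bc_pair (c *: h + h') kappa y = c * bc_pair h kappa y + bc_pair h' kappa y;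
  bc_pairE : forall x f kappa y,
    bc_pair (bc_tens x f) kappa y = gpair x kappa * bc_fpair f y }.

(** * Elements of H and of its dual, and the regular modules *)

(* The element k f of H, for k in K and f in the enlargement of F(L). *)
Definition elH (R : realType) (K L : lieGroup R) (B : bicrossproduct K L)
    (k : K) (f : bc_fun B) : bc_alg B :=
  bc_tens (glike (bc_K B) k) f.

Definition grpH (R : realType) (K L : lieGroup R) (B : bicrossproduct K L)
    (k : K) : bc_alg B := elH k 1.

Definition funH (R : realType) (K L : lieGroup R) (B : bicrossproduct K L)
    (f : L -> R[i]) : bc_alg B := bc_tens 1 (bc_res B f).

Definition actF (R : realType) (K L : lieGroup R) (B : bicrossproduct K L)
    (f : L -> R[i]) (k : K) : bc_fun B :=
  bc_act (bc_res B f) (glike (bc_K B) k).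

(* The element kappa l of H^*, as a functional on H. *)
Definition elHd (R : realType) (K L : lieGroup R) (B : bicrossproduct K L)
    (kappa : K -> R[i]) (l : L) : bc_alg B -> R[i] :=
  fun h => bc_pair h kappa (glike (bc_L B) l).
Arguments elHd {R K L} B kappa l _.

Definition eqHd_on (R : realType) (K L : lieGroup R) (B : bicrossproduct K L)
    (N : set K) (eta eta' : bc_alg B -> R[i]) : Prop :=
  forall k f, N k -> smooth_fun f ->
    eta (elH k (bc_res B f)) = eta' (elH k (bc_res B f)).

(* Elements of H^* are determined by their pairings with the elements k f,
   for k in K and f in F(L). *)
Definition eqHd (R : realType) (K L : lieGroup R) (B : bicrossproduct K L)
    (eta eta' : bc_alg B -> R[i]) : Prop := eqHd_on setT eta eta'.

Definition regR (H : nzRingType) (h h' : H) : H := h * h'.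
Definition regL (H : nzRingType) (h' h : H) : H := h' * h.
Definition dualL (H : nzRingType) (Z : Type) (h' : H) (eta : H -> Z) : H -> Z :=
  fun h => eta (h * h').
Definition dualR (H : nzRingType) (Z : Type) (eta : H -> Z) (h' : H) : H -> Z :=
  fun h => eta (h' * h).

Definition transL (R : realType) (K : lieGroup R) (k' : K) (kappa : K -> R[i])
    : K -> R[i] := fun k => kappa (k * k')%g.
Definition transR (R : realType) (K : lieGroup R) (kappa : K -> R[i]) (k' : K)
    : K -> R[i] := fun k => kappa (k' * k)%g.

(* The map k |-> k |> l ; its values are meaningful for k in hat_dom B l. *)
Definition hat (R : realType) (K L : lieGroup R) (B : bicrossproduct K L)
    (l : L) : K -> L := fun k => la_act (bc_loc B) k l.
Definition hat_dom (R : realType) (K L : lieGroup R) (B : bicrossproduct K L)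
    (l : L) : set K := [set k | la_dom (bc_loc B) (k, l)].

(* Main.v *)
(* Since each [k'] in K is group-like, the bicrossproduct multiplication reduces
   on the elements [k f] to [(k f)(k' f') = (k k')((f <| k') f')]; the two
   multiplication modules are read off from this formula, and the two dual ones
   by pairing it with [kappa l], which is multiplicative in [f] as [l] is
   group-like. *)
Require Import Defs.
From HB Require Import structures.
From mathcomp Require Import all_boot all_order all_algebra.
From mathcomp Require Import all_classical all_reals all_analysis.
From mathcomp Require Import complex.
Set Implicit Arguments.
Unset Strict Implicit.
Unset Printing Implicit Defensive.
Local Open Scope ring_scope.
Import GRing.Theory.

Section RegularModules.
Context (R : realType) (K L : lieGroup R) (B : bicrossproduct K L).
Implicit Types (k : K) (l : L) (f : bc_fun B).

(** Here [f] and [f'] range over the enlargement [bc_fun B], since the product involves [f] acted on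
    by [k'], which may leave F(L). *)
Lemma elH_mul k k' f f' :
  elH k f * elH k' f' = elH (k * k')%g (bc_act f (glike (bc_K B) k') * f').
Proof.
have [tensl tensr] := bc_tens_bilin B; have [_ actr] := bc_act_bilin B.
rewrite /elH bc_mul glikeM.
(* [tens_eq] permits replacing the coproduct only under a bilinear map, so the summand is exhibited
   as one; its bilinearity is checked last. *)
have -> := glike_comul k'
  (B := fun x y => bc_tens (glike (bc_K B) k * x) (bc_act f y * f')).
  by rewrite big_seq1.
split=> [a v v' w|a v w w'] /=.
  by rewrite mulrDr -scalerAr tensl.
by rewrite actr mulrDl -scalerAl tensr.
Qed.

(** Brings products with functions on L within the reach of [elH_mul]. *)
Lemma funHE (lam : L -> R[i]) : funH B lam = elH 1%g (bc_res B lam).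
Proof. by rewrite /funH /elH glike1. Qed.

Lemma bc_act_glike1 f : bc_act f (glike (bc_K B) 1%g) = f.
Proof. by rewrite glike1 bc_act1. Qed.

Lemma bc_act1_glike k : bc_act (1 : bc_fun B) (glike (bc_K B) k) = 1.
Proof. by rewrite bc_act_alg1 glike_counit scale1r. Qed.

Lemma bc_fpairM_glike f f' l :
  bc_fpair (f * f') (glike (bc_L B) l) =
  bc_fpair f (glike (bc_L B) l) * bc_fpair f' (glike (bc_L B) l).
Proof.
have [_ pairr] := bc_fpair_bilin B.
rewrite bc_fpairM.
(* Scalars are viewed as the module [R[i]^o], so that the product of two pairings is a bilinear
   map. *)
have -> := glike_comul l
  (Z := R[i]^o) (B := fun x y => bc_fpair f x * bc_fpair f' y).
  by rewrite big_seq1.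
split=> [a v v' w|a v w w'] /=; rewrite pairr.
  by rewrite mulrDl -scalerAl.
by rewrite mulrDr mulrCA.
Qed.

Lemma bc_fpair_res_glike (lam : L -> R[i]) l : smooth_fun lam ->
  bc_fpair (bc_res B lam) (glike (bc_L B) l) = lam l.
Proof. by move=> slam; rewrite bc_fpair_res // gpair_glike. Qed.

(** An arbitrary [kappa] allows for the factor [lam' (hat B l x)], meaningful only on
    [hat_dom B l]. *)
Lemma elHd_elH (kappa : K -> R[i]) l k f :
  elHd B kappa l (elH k f) = kappa k * bc_fpair f (glike (bc_L B) l).
Proof. by rewrite /elHd /elH bc_pairE gpair_glike. Qed.

End RegularModules.

Theorem theorem4p2 (R : realType) (K L : lieGroup R) (B : bicrossproduct K L)
    (k k' : K) (lam lam' : L -> R[i]) (kappa : K -> R[i]) (l : L)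
    (hlam : smooth_fun lam) (hlam' : smooth_fun lam')
    (hkappa : smooth_fun kappa) :
  [/\ (* (H, prec, H) *)
      regR (elH k (bc_res B lam)) (grpH B k') = elH (k * k')%g (actF B lam k') /\
      regR (elH k (bc_res B lam)) (funH B lam') =
        elH k (bc_res B (fun m => lam m * lam' m)),
      (* (H^*, succ, H) *)
      (hat_dom B l k' ->
         eqHd (dualL (grpH B k') (elHd B kappa l))
              (elHd B (transL k' kappa) (la_act (bc_loc B) k' l))) /\
      eqHd (dualL (funH B lam') (elHd B kappa l))
           (fun h => lam' l * elHd B kappa l h),
      (* (H, succ, H) *)
      regL (grpH B k') (elH k (bc_res B lam)) = elH (k' * k)%g (bc_res B lam) /\
      regL (funH B lam') (elH k (bc_res B lam)) =
        elH k (actF B lam' k * bc_res B lam)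
    & (* (H^*, prec, H) *)
      eqHd (dualR (elHd B kappa l) (grpH B k')) (elHd B (transR kappa k') l) /\
      eqHd_on (hat_dom B l)
        (dualR (elHd B kappa l) (funH B lam'))
        (elHd B (fun x => kappa x * lam' (hat B l x)) l)].
Proof.
split; split.
- by rewrite /regR /grpH elH_mul mulr1.
- by rewrite /regR funHE elH_mul mulg1 bc_act_glike1 bc_resM.
(* The test function [f] is acted on by the fixed [k'], so the domain condition bears on [k']. *)
- move=> domk' x f _ sf.
  rewrite /dualL /grpH elH_mul mulr1 !elHd_elH bc_fpair_act //.
  by rewrite bc_fpair_res_glike.
- move=> x f _ sf; rewrite /dualL funHE elH_mul mulg1 bc_act_glike1 !elHd_elH.
  by rewrite bc_fpairM_glike !bc_fpair_res_glike // mulrA mulrC.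
- by rewrite /regL /grpH elH_mul bc_act1_glike mul1r.
- by rewrite /regL funHE elH_mul mul1g.
- move=> x f _ sf.
  by rewrite /dualR /grpH elH_mul bc_act1_glike mul1r !elHd_elH.
(* Now [lam'] is acted on by the test point [x], so the identity is restricted to [x] in
   [hat_dom B l]. *)
- move=> x f domx sf; rewrite /dualR funHE elH_mul mul1g !elHd_elH.
  by rewrite bc_fpairM_glike bc_fpair_act // mulrA.
Qed.
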